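(* Let $n\ge 3$ be an integer, let $\mathcal{G}=\begin{bmatrix}A&M\\ N&B\end{bmatrix}$ be a generalized matrix algebra over the commutative ring $\mathcal{R}$ and let $\varphi:\mathcal{G}^n\to\mathcal{G}$ be an $n$-Lie derivation. Suppose that: (1) $\pi_A(\mathcal{Z}(\mathcal{G}))=\mathcal{Z}(A)$ and $\pi_B(\mathcal{Z}(\mathcal{G}))=\mathcal{Z}(B)$; (2) at least one of the algebras $A$, $B$ does not contain nonzero central ideals; (3) for each $u\in N$, the condition $Mu=0=uM$ implies $u=0$; (4) for each $m\in M$, the condition $Nm=0=mN$ implies $m=0$; (5) each special pair of bimodule homomorphisms has standard form. Then $\varphi=\kappa+\psi$, where $\kappa$ is an extremal $n$-derivation given by $\kappa(x_1,\dots,x_n)=[x_1,[x_2,[\cdots,[x_n,X_0]\cdots]]]$ for all $x_1,\dots,x_n\in\mathcal{G}$, with $X_0=e\varphi(e,e,\dots,e)f+(-1)^n f\varphi(e,e,\dots,e)e$, and $\psi:\mathcal{G}^n\to\mathcal{Z}(\mathcal{G})$ is an $n$-linear central-valued mapping vanishing on commutators in each component (i.e. $\psi(x_1,\dots,x_n)=0$ whenever some $x_i$ is a commutator $[x,y]$ with $x,y\in\mathcal{G}$).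
   Context: $\mathcal{R}$ is a commutative ring with identity, assumed $2$-torsionfree. All algebras are associative $\mathcal{R}$-algebras; $[x,y]=xy-yx$ and $\mathcal{Z}(\cdot)$ denotes the center. A central ideal of an algebra is an ideal contained in its center. Generalized matrix algebra: let $A,B$ be unital $\mathcal{R}$-algebras, $M$ an $(A,B)$-bimodule, $N$ a $(B,A)$-bimodule (at least one of $M,N$ nonzero), and let $\Phi_{MN}:M\otimes_B N\to A$, $\Psi_{NM}:N\otimes_A M\to B$ be bimodule homomorphisms (write $mn=\Phi_{MN}(m\otimes n)$, $nm=\Psi_{NM}(n\otimes m)$) with $(mn)m'=m(nm')$ and $(nm)n'=n(mn')$ for all $m,m'\in M$, $n,n'\in N$ (a Morita context). Then $\mathcal{G}=\begin{bmatrix}A&M\\ N&B\end{bmatrix}$ is the $\mathcal{R}$-algebra of formal matrices with matrix addition and multiplication. Standing assumption: $M$ is faithful as a left $A$-module and as a right $B$-module. $A,M,N,B$ are identified with the corresponding corners of $\mathcal{G}$, so $\mathcal{G}=A+M+N+B$. Put $e=\begin{bmatrix}1_A&0\\0&0\end{bmatrix}$, $f=\begin{bmatrix}0&0\\0&1_B\end{bmatrix}$. The maps $\pi_A,\pi_B$ send $\begin{bmatrix}a&m\\ n&b\end{bmatrix}$ to $a$ and $b$ respectively. $Mu=0$ means $mu=0$ for all $m\in M$, and similarly for the other products. A Lie derivation is an $\mathcal{R}$-linear map $\rho:\mathcal{G}\to\mathcal{G}$ with $\rho([x,y])=[\rho(x),y]+[x,\rho(y)]$. An $n$-Lie derivation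 is an $n$-linear map $\mathcal{G}^n\to\mathcal{G}$ that is a Lie derivation in each component (the others being fixed). An extremal $n$-derivation is an $n$-linear map of the form $(x_1,\dots,x_n)\mapsto[x_1,[x_2,\cdots,[x_n,X_0]\cdots]]$ for some $X_0\in\mathcal{G}$ with $[[x,y],X_0]=0$ for all $x,y\in\mathcal{G}$. A special pair $(\mathcal{F},\mathcal{E})$ consists of an $(A,B)$-bimodule homomorphism $\mathcal{F}:M\to M$ and a $(B,A)$-bimodule homomorphism $\mathcal{E}:N\to N$ with $\mathcal{F}(m)n+m\mathcal{E}(n)=0=n\mathcal{F}(m)+\mathcal{E}(n)m$ for all $m\in M,n\in N$. It has standard form if there are $\omega_0\in\mathcal{Z}(A)$, $\omega_1\in\mathcal{Z}(B)$ with $\mathcal{F}(m)=\omega_0m+m\omega_1$ and $\mathcal{E}(n)=-n\omega_0-\omega_1n$ for all $m\in M,n\in N$. *)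

(* Defs.v *)
From HB Require Import structures.
From mathcomp Require Import all_boot all_order all_algebra.

Set Implicit Arguments.
Unset Strict Implicit.
Unset Printing Implicit Defensive.

Import GRing.Theory.
Local Open Scope ring_scope.

Reserved Notation "a *<| m" (at level 40, left associativity).
Reserved Notation "m |>* b" (at level 40, left associativity).

Section Rings.
Variable T : pzRingType.

Definition center (z : T) : Prop := forall x : T, GRing.comm z x.

Definition lbr (x y : T) : T := x * y - y * x.

(* Closure under the scalars is automatic in a unital algebra. *)
Definition two_sided_ideal (I : T -> Prop) : Prop :=
  [/\ I 0, forall x y, I x -> I y -> I (x - y),
      forall a x, I x -> I (a * x) & forall a x, I x -> I (x * a)].

Definition central_ideal (I : T -> Prop) : Prop :=
  two_sided_ideal I /\ forall x, I x -> center x.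

Definition no_nonzero_central_ideal : Prop :=
  forall I : T -> Prop, central_ideal I -> forall x, I x -> x = 0.

End Rings.

(* Unital bimodules on which the base ring acts in the same way through A,
   through B and through the given scaling. *)
HB.mixin Record Lmodule_isBimodule (R : comPzRingType) (A B : algType R) M
    of GRing.Lmodule R M := {
  lact : A -> M -> M;
  ract : M -> B -> M;
  lactDl : forall m, {morph lact^~ m : a a' / a + a'};
  lactDr : forall a, {morph lact a : m m' / m + m'};
  lactA : forall a a' m, lact a (lact a' m) = lact (a * a') m;
  lact1 : forall m, lact 1 m = m;
  lact_scal : forall (r : R) m, lact r%:A m = r *: m;
  ractDl : forall b, {morph ract^~ b : m m' / m + m'};
  ractDr : forall m, {morph ract m : b b' / b + b'};
  ractA : forall m b b', ract (ract m b) b' = ract m (b * b');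
  ract1 : forall m, ract m 1 = m;
  ract_scal : forall (r : R) m, ract m r%:A = r *: m;
  lractA : forall a m b, ract (lact a m) b = lact a (ract m b)
}.

#[short(type="bimodType")]
HB.structure Definition Bimodule (R : comPzRingType) (A B : algType R) :=
  { M of GRing.Lmodule R M & Lmodule_isBimodule R A B M }.

Notation "a *<| m" := (lact a m) : ring_scope.
Notation "m |>* b" := (ract m b) : ring_scope.

Section BimoduleTheory.
Variables (R : comPzRingType) (A B : algType R) (M : bimodType A B).
Implicit Types (r : R) (a : A) (b : B) (m : M).

Lemma lact0l m : 0 *<| m = 0 :> M.
Proof. by apply: (addIr (0 *<| m)); rewrite -lactDl !add0r. Qed.

Lemma lact0r a : a *<| 0 = 0 :> M.
Proof. by apply: (addIr (a *<| 0)); rewrite -lactDr !add0r. Qed.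

Lemma ract0l b : (0 : M) |>* b = 0.
Proof. by apply: (addIr ((0 : M) |>* b)); rewrite -ractDl !add0r. Qed.

Lemma ract0r m : m |>* (0 : B) = 0.
Proof. by apply: (addIr (m |>* (0 : B))); rewrite -ractDr !add0r. Qed.

Lemma lactZl r a m : (r *: a) *<| m = r *: (a *<| m).
Proof. by rewrite -mulr_algl -lactA lact_scal. Qed.

Lemma lactZr r a m : a *<| (r *: m) = r *: (a *<| m).
Proof. by rewrite -lact_scal lactA mulr_algr lactZl. Qed.

Lemma ractZr r m b : m |>* (r *: b) = r *: (m |>* b).
Proof. by rewrite -mulr_algr -ractA ract_scal. Qed.

Lemma ractZl r m b : (r *: m) |>* b = r *: (m |>* b).
Proof. by rewrite -ract_scal ractA mulr_algl ractZr. Qed.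

End BimoduleTheory.

Definition bimod_hom (R : comPzRingType) (A B : algType R)
    (M M' : bimodType A B) (F : M -> M') : Prop :=
  [/\ linear F, forall (a : A) m, F (a *<| m) = a *<| F m
    & forall m (b : B), F (m |>* b) = F m |>* b].

Definition left_faithful (R : comPzRingType) (A B : algType R)
    (M : bimodType A B) : Prop :=
  forall a : A, (forall m : M, a *<| m = 0) -> a = 0.

Definition right_faithful (R : comPzRingType) (A B : algType R)
    (M : bimodType A B) : Prop :=
  forall b : B, (forall m : M, m |>* b = 0) -> b = 0.

(* A bimodule homomorphism out of a tensor product, such as M (x)_B N -> A, is
   given by the biadditive balanced map it corresponds to under the universal
   property; MN m n is the product mn in A and NM n m the product nm in B.
   R-bilinearity follows from linearity over A and B. *)
Record moritaContext (R : comPzRingType) (A B : algType R)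
    (M : bimodType A B) (N : bimodType B A) := MoritaContext {
  MN : M -> N -> A;
  NM : N -> M -> B;
  MN_Dl : forall n, {morph MN^~ n : m m' / m + m'};
  MN_Dr : forall m, {morph MN m : n n' / n + n'};
  MN_balanced : forall m (b : B) n, MN (m |>* b) n = MN m (b *<| n);
  MN_l : forall (a : A) m n, MN (a *<| m) n = a * MN m n;
  MN_r : forall m n (a : A), MN m (n |>* a) = MN m n * a;
  NM_Dl : forall m, {morph NM^~ m : n n' / n + n'};
  NM_Dr : forall n, {morph NM n : m m' / m + m'};
  NM_balanced : forall n (a : A) m, NM (n |>* a) m = NM n (a *<| m);
  NM_l : forall (b : B) n m, NM (b *<| n) m = b * NM n m;
  NM_r : forall n m (b : B), NM n (m |>* b) = NM n m * b;
  MN_NM : forall m n m', MN m n *<| m' = m |>* NM n m';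
  NM_MN : forall n m n', NM n m *<| n' = n |>* MN m n'
}.

(* ((a, m), (n, b)) stands for the matrix with rows (a, m) and (n, b). *)
Definition gma (R : comPzRingType) (A B : algType R) (M : bimodType A B)
    (N : bimodType B A) (K : moritaContext M N) : Type :=
  ((A * M) * (N * B))%type.

Section GMA.
Variables (R : comPzRingType) (A B : algType R).
Variables (M : bimodType A B) (N : bimodType B A) (K : moritaContext M N).

HB.instance Definition _ :=
  GRing.Lmodule.copy (gma K) ((A * M) * (N * B))%type.

Implicit Types x y z : gma K.

Definition gmx (a : A) (m : M) (n : N) (b : B) : gma K := ((a, m), (n, b)).

Definition gA x : A := x.1.1.
Definition gM x : M := x.1.2.
Definition gN x : N := x.2.1.
Definition gB x : B := x.2.2.

Definition gma_one : gma K := gmx 1 0 0 1.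

Definition gma_mul x y : gma K :=
  gmx (gA x * gA y + MN K (gM x) (gN y)) (gA x *<| gM y + gM x |>* gB y)
      (gN x |>* gA y + gB x *<| gN y)    (NM K (gN x) (gM y) + gB x * gB y).

Lemma MN0l n : MN K 0 n = 0.
Proof. by apply: (addIr (MN K 0 n)); rewrite -MN_Dl !add0r. Qed.

Lemma MN0r m : MN K m 0 = 0.
Proof. by apply: (addIr (MN K m 0)); rewrite -MN_Dr !add0r. Qed.

Lemma NM0l m : NM K 0 m = 0.
Proof. by apply: (addIr (NM K 0 m)); rewrite -NM_Dl !add0r. Qed.

Lemma NM0r n : NM K n 0 = 0.
Proof. by apply: (addIr (NM K n 0)); rewrite -NM_Dr !add0r. Qed.

Lemma MNZl (r : R) m n : MN K (r *: m) n = r *: MN K m n.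
Proof. by rewrite -lact_scal MN_l mulr_algl. Qed.

Lemma MNZr (r : R) m n : MN K m (r *: n) = r *: MN K m n.
Proof. by rewrite -ract_scal MN_r mulr_algr. Qed.

Lemma NMZl (r : R) n m : NM K (r *: n) m = r *: NM K n m.
Proof. by rewrite -lact_scal NM_l mulr_algl. Qed.

Lemma NMZr (r : R) n m : NM K n (r *: m) = r *: NM K n m.
Proof. by rewrite -ract_scal NM_r mulr_algr. Qed.

Lemma gma_mulA : associative gma_mul.
Proof.
move=> [[a m] [n b]] [[a' m'] [n' b']] [[a'' m''] [n'' b'']].
rewrite /gma_mul /gmx /gA /gM /gN /gB /=; congr ((_, _), (_, _)).
- by rewrite !mulrDr !mulrDl MN_Dl MN_Dr mulrA -MN_l MN_r MN_balanced !addrA;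
    congr (_ + _); rewrite -!addrA; congr (_ + _); rewrite addrC.
- by rewrite !lactDr !lactDl !ractDl !ractDr lactA -lractA MN_NM ractA !addrA;
    congr (_ + _); rewrite -!addrA; congr (_ + _); rewrite addrC.
- by rewrite !lactDr !lactDl !ractDl !ractDr lactA -lractA NM_MN ractA !addrA;
    congr (_ + _); rewrite -!addrA; congr (_ + _); rewrite addrC.
- by rewrite !mulrDr !mulrDl NM_Dl NM_Dr mulrA NM_balanced NM_r NM_l !addrA;
    congr (_ + _); rewrite -!addrA; congr (_ + _); rewrite addrC.
Qed.

Lemma gma_mul1r : left_id gma_one gma_mul.
Proof.
case=> [[a m] [n b]]; rewrite /gma_mul /gmx /gA /gM /gN /gB /=.
by rewrite !mul1r MN0l NM0l !lact1 !ract0l !addr0 !add0r.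
Qed.

Lemma gma_mulr1 : right_id gma_one gma_mul.
Proof.
case=> [[a m] [n b]]; rewrite /gma_mul /gmx /gA /gM /gN /gB /=.
by rewrite !mulr1 MN0r NM0r !ract1 !lact0r !addr0 !add0r.
Qed.

Lemma gma_mulDl : left_distributive gma_mul +%R.
Proof.
move=> [[a m] [n b]] [[a' m'] [n' b']] [[a'' m''] [n'' b'']].
rewrite /gma_mul /gmx /gA /gM /gN /gB /=; congr ((_, _), (_, _)) => /=.
- by rewrite mulrDl MN_Dl addrACA.
- by rewrite lactDl ractDl addrACA.
- by rewrite lactDl ractDl addrACA.
- by rewrite mulrDl NM_Dl addrACA.
Qed.

Lemma gma_mulDr : right_distributive gma_mul +%R.
Proof.
move=> [[a m] [n b]] [[a' m'] [n' b']] [[a'' m''] [n'' b'']].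
rewrite /gma_mul /gmx /gA /gM /gN /gB /=; congr ((_, _), (_, _)) => /=.
- by rewrite mulrDr MN_Dr addrACA.
- by rewrite lactDr ractDr addrACA.
- by rewrite lactDr ractDr addrACA.
- by rewrite mulrDr NM_Dr addrACA.
Qed.

Lemma gma_oner_neq0 : gma_one != 0.
Proof. by apply/eqP => -[/eqP]; rewrite oner_eq0. Qed.

HB.instance Definition _ := GRing.Zmodule_isNzRing.Build (gma K)
  gma_mulA gma_mul1r gma_mulr1 gma_mulDl gma_mulDr gma_oner_neq0.

Lemma gma_scalerAl (r : R) x y : r *: (x * y) = (r *: x) * y.
Proof.
case: x y => [[a m] [n b]] [[a' m'] [n' b']]; congr ((_, _), (_, _)) => /=.
- by rewrite scalerDr scalerAl MNZl.
- by rewrite scalerDr lactZl ractZl.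
- by rewrite scalerDr lactZl ractZl.
- by rewrite scalerDr scalerAl NMZl.
Qed.

HB.instance Definition _ :=
  GRing.Lmodule_isLalgebra.Build R (gma K) gma_scalerAl.

Lemma gma_scalerAr (r : R) x y : r *: (x * y) = x * (r *: y).
Proof.
case: x y => [[a m] [n b]] [[a' m'] [n' b']]; congr ((_, _), (_, _)) => /=.
- by rewrite scalerDr scalerAr MNZr.
- by rewrite scalerDr lactZr ractZr.
- by rewrite scalerDr lactZr ractZr.
- by rewrite scalerDr scalerAr NMZr.
Qed.

HB.instance Definition _ :=
  GRing.Lalgebra_isAlgebra.Build R (gma K) gma_scalerAr.

Definition gma_e : gma K := gmx 1 0 0 0.
Definition gma_f : gma K := gmx 0 0 0 1.

Definition special_pair (F : M -> M) (E : N -> N) : Prop :=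
  [/\ bimod_hom F, bimod_hom E,
      forall m n, MN K (F m) n + MN K m (E n) = 0
    & forall m n, NM K n (F m) + NM K (E n) m = 0].

End GMA.

Definition standard_form (R : comPzRingType) (A B : algType R)
    (M : bimodType A B) (N : bimodType B A) (F : M -> M) (E : N -> N) : Prop :=
  exists (w0 : A) (w1 : B),
    [/\ center w0, center w1,
        forall m, F m = w0 *<| m + m |>* w1
      & forall n, E n = - (n |>* w0) - w1 *<| n].

Section MultilinearMaps.
Variables (R : comPzRingType) (G : algType R) (n : nat).
Implicit Types (x : G ^ n) (phi : G ^ n -> G).

(* The tuple x with its i-th component replaced by y. *)
Definition upd x (i : 'I_n) (y : G) : G ^ n :=
  [ffun j => if j == i then y else x j].

Definition multilinear phi : Prop :=
  forall x i, linear (fun y : G => phi (upd x i y)).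

Definition lie_derivation (rho : G -> G) : Prop :=
  linear rho /\
  forall y z : G, rho (lbr y z) = lbr (rho y) z + lbr y (rho z).

Definition n_lie_derivation phi : Prop :=
  multilinear phi /\
  forall x i, lie_derivation (fun y : G => phi (upd x i y)).

(* [x_1, [x_2, ... [x_n, X0] ... ]] *)
Definition iter_lbr x (X0 : G) : G := foldr (@lbr G) X0 [seq x i | i : 'I_n].

Definition extremal_nder_of (X0 : G) phi : Prop :=
  [/\ multilinear phi, forall x y : G, lbr (lbr x y) X0 = 0
    & forall x, phi x = iter_lbr x X0].

Definition central_valued phi : Prop := forall x, center (phi x).

Definition vanishes_on_commutators phi : Prop :=
  forall x i (y z : G), x i = lbr y z -> phi x = 0.

End MultilinearMaps.

(* Main.v *)
Require Import Defs.
From HB Require Import structures.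
From mathcomp Require Import all_boot all_order all_algebra.

Set Implicit Arguments.
Unset Strict Implicit.
Unset Printing Implicit Defensive.

Import GRing.Theory.
Local Open Scope ring_scope.

(** Why the theorem holds: under the hypotheses phi itself is central-valued,
    so that X0 = 0, the extremal part vanishes and psi = phi.  A Lie derivation
    with central values kills every commutator, because a commutator is sent to
    a sum of two brackets with a central entry.

    To see that phi is central-valued, only two slots are varied at a time,
    giving maps d : G -> G -> G that are Lie derivations in each variable.

    First, d e e is central ([bi_lie_e_e]).  The diagonal part of D e is central
    for each Lie derivation D ([center_diag_lie_der_e]).  If u is the N-part of
    d e e, then applying this to D = d(-, m) shows that mu - um is central for
    all m in M.  The elements mu form a left ideal of A and the um a right ideal
    of B, so one of these families vanishes; faithfulness of M makes the other
    one vanish, and the condition on N gives u = 0 ([eq0_of_central_lbr_inN]).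
    The M-part is similar.

    Secondly, if d e z and d z e are central for all z, then d is central-valued
    ([bi_lie_central]).  Expanding d [e, x] [y, v] in two ways gives
      [d x y, [e, v]] = [d x v, [e, y]]      ([bi_lie_exchange]),
    so d x y is central when x or y is diagonal.  For x off-diagonal the Lie
    derivation D = d x kills the diagonal.  Write D m = F m + P m on M and
    D n = Q n + E n on N.  Then (F, E) is a special pair, hence F is
    multiplication by a central element of A, and by one of B; the
    multipliers obtained from all such x form a central ideal of A or of B, and
    vanish ([central_scaling_family_eq0]).  The parts P and Q, which exchange M
    and N, are skew bimodule maps, and the exchange identity makes the brackets
    [m, P y] and [Q y, n] central, so P = Q = 0 by the argument used
    for d e e ([kill_diag_skew_eq0]).

    With three slots i, j, k the two facts combine: phi is central as soon as
    two arguments are e; so, applying the second fact to slots j and k, as soon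
    as the argument in slot i is e; so, applying it once more, always. *)

(** * Brackets and centers *)

Section LieBracket.
Variable T : pzRingType.
Implicit Types x y z t : T.

Lemma lbr0l x : lbr 0 x = 0.
Proof. by rewrite /lbr mul0r mulr0 subrr. Qed.

Lemma lbr0r x : lbr x 0 = 0.
Proof. by rewrite /lbr mul0r mulr0 subrr. Qed.

Lemma lbr_anti x y : lbr x y = - lbr y x.
Proof. by rewrite /lbr opprB. Qed.

Lemma lbrDr x y z : lbr x (y + z) = lbr x y + lbr x z.
Proof. by rewrite /lbr mulrDr mulrDl opprD addrACA. Qed.

Lemma lbrNr x y : lbr x (- y) = - lbr x y.
Proof. by apply: (addIr (lbr x y)); rewrite -lbrDr !addNr lbr0r. Qed.

(** The Jacobi identity, in the form used to move [lbr e] through a bracket. *)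
Lemma lbr_leibniz x y z :
  lbr x (lbr y z) = lbr (lbr x y) z + lbr y (lbr x z).
Proof.
rewrite /lbr !mulrBr !mulrBl !mulrA !opprB [RHS]addrACA !addrA !subrK.
rewrite [LHS]addrAC -!addrA; congr (_ + _).
by rewrite addrCA [- (x * z * y) + _]addrC.
Qed.

Lemma center_lbrl z x : center z -> lbr z x = 0.
Proof. by move=> /(_ x) zx; rewrite /lbr zx subrr. Qed.

Lemma center_lbrr z x : center z -> lbr x z = 0.
Proof. by move=> zc; rewrite lbr_anti center_lbrl ?oppr0. Qed.

Lemma centerP z : center z <-> forall x, lbr z x = 0.
Proof.
split=> [zc x | zc x]; first exact: center_lbrl.
by apply/eqP; rewrite -subr_eq0; apply/eqP/zc.
Qed.

Lemma center0 : center (0 : T).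
Proof. by move=> x; rewrite /GRing.comm mul0r mulr0. Qed.

Lemma centerN x : center x -> center (- x).
Proof. by move=> xc z; rewrite /GRing.comm mulNr mulrN xc. Qed.

Lemma centerD x y : center x -> center y -> center (x + y).
Proof. by move=> xc yc z; apply/commr_sym/commrD; apply/commr_sym. Qed.

(** Centrality of all the x t makes the left ideal T t two-sided, since
    x t y = y x t. *)
Lemma no_central_ideal_mull t :
  no_nonzero_central_ideal T -> (forall x, center (x * t)) -> t = 0.
Proof.
move=> noI tc; apply: (noI (fun y => exists x, y = x * t)); last first.
  by exists 1; rewrite mul1r.
split; last by move=> _ [x ->].
split; first by exists 0; rewrite mul0r.
- by move=> _ _ [x ->] [y ->]; exists (x - y); rewrite mulrBl.
- by move=> x _ [y ->]; exists (x * y); rewrite mulrA.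
by move=> x _ [y ->]; exists (x * y); rewrite tc mulrA.
Qed.

Lemma no_central_ideal_mulr t :
  no_nonzero_central_ideal T -> (forall x, center (t * x)) -> t = 0.
Proof.
move=> noI tc; apply: no_central_ideal_mull => // x.
by have := tc 1; rewrite mulr1 => /(_ x) <-.
Qed.

End LieBracket.

(** * Lie derivations *)

Section LieDerivation.
Variables (R : comPzRingType) (G : algType R) (D : G -> G).
Hypothesis lieD : lie_derivation D.

Lemma lie_derD x y : D (x + y) = D x + D y.
Proof. by have := lieD.1 1 x y; rewrite !scale1r. Qed.

Lemma lie_der0 : D 0 = 0.
Proof. by apply: (addIr (D 0)); rewrite -lie_derD !add0r. Qed.

Lemma lie_derN x : D (- x) = - D x.
Proof. by apply: (addIr (D x)); rewrite -lie_derD !addNr lie_der0. Qed.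

Lemma lie_der_lbr_center_l y z : center (D y) -> D (lbr y z) = lbr y (D z).
Proof. by move=> yc; rewrite lieD.2 (center_lbrl _ yc) add0r. Qed.

End LieDerivation.

(** * Signs in a Morita context *)

Section BimoduleOpposites.
Variables (R : comPzRingType) (A B : algType R) (M : bimodType A B).
Variables (N : bimodType B A) (K : moritaContext M N).

Lemma lactNr (a : A) (m : M) : a *<| - m = - (a *<| m).
Proof. by rewrite -!scaleN1r lactZr. Qed.

Lemma ractNl (m : M) (b : B) : (- m) |>* b = - (m |>* b).
Proof. by rewrite -!scaleN1r ractZl. Qed.

Lemma NMNl (n : N) (m : M) : NM K (- n) m = - NM K n m.
Proof. by rewrite -!scaleN1r NMZl. Qed.

Lemma NMNr (n : N) (m : M) : NM K n (- m) = - NM K n m.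
Proof. by rewrite -!scaleN1r NMZr. Qed.

End BimoduleOpposites.

Definition bi_lie_derivation (R : comPzRingType) (G : algType R)
    (d : G -> G -> G) : Prop :=
  (forall x, lie_derivation (d x)) /\ (forall y, lie_derivation (d^~ y)).

(** * Peirce components of brackets *)

Section Peirce.
Variables (R : comPzRingType) (A B : algType R).
Variables (M : bimodType A B) (N : bimodType B A) (K : moritaContext M N).
Local Notation G := (gma K).
Local Notation e := (gma_e K).
Implicit Types (x y z : G) (a : A) (m : M) (n : N) (b : B).

Definition inA a : G := gmx K a 0 0 0.
Definition inM m : G := gmx K 0 m 0 0.
Definition inN n : G := gmx K 0 0 n 0.
Definition inB b : G := gmx K 0 0 0 b.
Definition diag z : G := gmx K (gA z) 0 0 (gB z).

Definition simp0 := (lact0l, lact0r, ract0l, ract0r, MN0l, MN0r, NM0l, NM0r,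
  @lact1 R A B M, @lact1 R B A N, @ract1 R A B M, @ract1 R B A N,
  mul1r, mulr1, mul0r, mulr0, addr0, add0r, subr0, sub0r, subrr, oppr0).

Lemma gma_split x : x = diag x + inM (gM x) + inN (gN x).
Proof.
by case: x => [[a m] [n b]]; congr ((_, _), (_, _)); rewrite /= !simp0.
Qed.

Lemma diag_split x : diag x = inA (gA x) + inB (gB x).
Proof.
by case: x => [[a m] [n b]]; congr ((_, _), (_, _)); rewrite /= !simp0.
Qed.

Lemma lbr_gmx a m n b a' m' n' b' :
  lbr (gmx K a m n b) (gmx K a' m' n' b') =
  gmx K (a * a' + MN K m n' - (a' * a + MN K m' n))
        (a *<| m' + m |>* b' - (a' *<| m + m' |>* b))
        (n |>* a' + b *<| n' - (n' |>* a + b' *<| n))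
        (NM K n m' + b * b' - (NM K n' m + b' * b)).
Proof. by []. Qed.

Lemma gA_gmx a m n b : gA (gmx K a m n b) = a. Proof. by []. Qed.
Lemma gM_gmx a m n b : gM (gmx K a m n b) = m. Proof. by []. Qed.
Lemma gN_gmx a m n b : gN (gmx K a m n b) = n. Proof. by []. Qed.
Lemma gB_gmx a m n b : gB (gmx K a m n b) = b. Proof. by []. Qed.
Lemma gA_D x y : gA (x + y) = gA x + gA y. Proof. by []. Qed.
Lemma gM_D x y : gM (x + y) = gM x + gM y. Proof. by []. Qed.
Lemma gN_D x y : gN (x + y) = gN x + gN y. Proof. by []. Qed.
Lemma gB_D x y : gB (x + y) = gB x + gB y. Proof. by []. Qed.
Lemma gA_N x : gA (- x) = - gA x. Proof. by []. Qed.
Lemma gM_N x : gM (- x) = - gM x. Proof. by []. Qed.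
Lemma gN_N x : gN (- x) = - gN x. Proof. by []. Qed.
Lemma gB_N x : gB (- x) = - gB x. Proof. by []. Qed.

(* The rules for sums and opposites come first: the rules for [gmx] also match
   a sum or an opposite, by unfolding the pairs. *)
Definition comps := (gA_D, gM_D, gN_D, gB_D, gA_N, gM_N, gN_N, gB_N,
  gA_gmx, gM_gmx, gN_gmx, gB_gmx).

Lemma lbr_e z : lbr e z = gmx K 0 (gM z) (- gN z) 0.
Proof. by case: z => [[a m] [n b]]; rewrite lbr_gmx /= !simp0. Qed.

Lemma lbr_e_inM m : lbr e (inM m) = inM m.
Proof. by rewrite lbr_e /= oppr0. Qed.

Lemma lbr_e_inN n : lbr e (inN n) = - inN n.
Proof. by rewrite lbr_e; congr ((_, _), (_, _)); rewrite oppr0. Qed.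

Lemma lbr_e_diag z : lbr e (diag z) = 0.
Proof. by rewrite lbr_e /= oppr0. Qed.

Lemma lbr_inM z m :
  lbr z (inM m) = gmx K (- MN K m (gN z)) (gA z *<| m - m |>* gB z) 0
                       (NM K (gN z) m).
Proof. by case: z => [[a m'] [n b]]; rewrite lbr_gmx /= !simp0. Qed.

Lemma lbr_inN z n :
  lbr z (inN n) = gmx K (MN K (gM z) n) 0 (gB z *<| n - n |>* gA z)
                       (- NM K n (gM z)).
Proof. by case: z => [[a m] [n' b]]; rewrite lbr_gmx /= !simp0. Qed.

Lemma lbr_inA a z :
  lbr (inA a) z = gmx K (lbr a (gA z)) (a *<| gM z) (- (gN z |>* a)) 0.
Proof. by case: z => [[a' m] [n' b]]; rewrite lbr_gmx /= !simp0. Qed.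

Lemma lbr_inB b z :
  lbr (inB b) z = gmx K 0 (- (gM z |>* b)) (b *<| gN z) (lbr b (gB z)).
Proof. by case: z => [[a' m] [n' b']]; rewrite lbr_gmx /= !simp0. Qed.

Lemma gma_eq0 z : gA z = 0 -> gM z = 0 -> gN z = 0 -> gB z = 0 -> z = 0.
Proof.
by case: z => [[a m] [n b]]; rewrite /gA /gM /gN /gB /= => -> -> -> ->.
Qed.

Lemma lbr_inM_inN m n :
  lbr (inM m) (inN n) = gmx K (MN K m n) 0 0 (- NM K n m).
Proof. by rewrite lbr_inN /= !simp0. Qed.

Lemma center_offdiag z : center z -> gM z = 0 /\ gN z = 0.
Proof.
move=> zc; have := center_lbrr e zc; rewrite lbr_e => eq0; split.
  by have := congr1 (@gM _ _ _ _ _ K) eq0.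
by apply: oppr_inj; rewrite oppr0; have := congr1 (@gN _ _ _ _ _ K) eq0.
Qed.

Lemma center_actM z m : center z -> gA z *<| m = m |>* gB z.
Proof.
move=> zc; have := center_lbrl (inM m) zc.
by rewrite lbr_inM => /(congr1 (@gM _ _ _ _ _ K)) /= /subr0_eq.
Qed.

Lemma center_actN z n : center z -> gB z *<| n = n |>* gA z.
Proof.
move=> zc; have := center_lbrl (inN n) zc.
by rewrite lbr_inN => /(congr1 (@gN _ _ _ _ _ K)) /= /subr0_eq.
Qed.

Lemma center_gA z : center z -> center (gA z).
Proof.
move=> zc a; have := center_lbrr (inA a) zc.
by rewrite lbr_inA => /(congr1 (@gA _ _ _ _ _ K)) /= /subr0_eq.
Qed.

Lemma center_gB z : center z -> center (gB z).
Proof.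
move=> zc b; have := center_lbrr (inB b) zc.
by rewrite lbr_inB => /(congr1 (@gB _ _ _ _ _ K)) /= /subr0_eq.
Qed.

Lemma diag_gmx a m n b : diag (gmx K a m n b) = gmx K a 0 0 b.
Proof. by []. Qed.

Lemma diagD x y : diag (x + y) = diag x + diag y.
Proof. by congr ((_, _), (_, _)); rewrite /= addr0. Qed.

Lemma diagN x : diag (- x) = - diag x.
Proof. by congr ((_, _), (_, _)); rewrite /= oppr0. Qed.

(** As m = [e, m], the image D m is [D e, m] + [e, D m], and brackets with e
    are off-diagonal. *)
Lemma diag_lie_der_inM D m : lie_derivation D ->
  diag (D (inM m)) = lbr (inN (gN (D e))) (inM m).
Proof.
move=> lieD; rewrite -{1}(lbr_e_inM m) lieD.2 lbr_e !lbr_inM.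
by rewrite /diag !comps !simp0.
Qed.

Lemma diag_lie_der_inN D n : lie_derivation D ->
  diag (D (inN n)) = lbr (inN n) (inM (gM (D e))).
Proof.
move=> lieD; rewrite -{1}(opprK (inN n)) -(lbr_e_inN n) (lie_derN lieD) lieD.2.
rewrite lbr_e (lbr_anti (inN n) (inM _)) lbr_inM_inN lbr_inN diagN diagD.
by rewrite !diag_gmx; congr (- _); rewrite addr0.
Qed.

(** * Lie derivations that vanish on the diagonal *)

Section KillDiagonal.
Variable D : G -> G.
Hypotheses (lieD : lie_derivation D) (DA0 : forall a, D (inA a) = 0).
Hypothesis DB0 : forall b, D (inB b) = 0.

(* F and E preserve M and N, whereas P and Q exchange them. *)
Let F m := gM (D (inM m)).
Let P m := gN (D (inM m)).
Let E n := gN (D (inN n)).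
Let Q n := gM (D (inN n)).

Lemma kill_diag_lbr_inA a z : D (lbr (inA a) z) = lbr (inA a) (D z).
Proof. by apply: (lie_der_lbr_center_l lieD); rewrite DA0; apply: center0. Qed.

Lemma kill_diag_lbr_inB b z : D (lbr (inB b) z) = lbr (inB b) (D z).
Proof. by apply: (lie_der_lbr_center_l lieD); rewrite DB0; apply: center0. Qed.

(** D commutes with [lbr e], which is 1 on M and -1 on N; comparing the N-parts
    of D m = [e, D m] leaves P m = - P m. *)
Lemma kill_diag_inM m : D (inM m) = gmx K 0 (F m) (P m) 0 /\ - P m = P m.
Proof.
have DM : D (inM m) = gmx K 0 (F m) (- P m) 0.
  by rewrite -{1}(lbr_e_inM m) kill_diag_lbr_inA lbr_e.
have PN : - P m = P m by rewrite [in RHS]/P DM.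
by rewrite DM PN.
Qed.

Lemma kill_diag_inN n : D (inN n) = gmx K 0 (Q n) (E n) 0 /\ - Q n = Q n.
Proof.
have DN : D (inN n) = gmx K 0 (- Q n) (E n) 0.
  rewrite -{1}(opprK (inN n)) -lbr_e_inN (lie_derN lieD) kill_diag_lbr_inA.
  by rewrite lbr_e; congr ((_, _), (_, _)); rewrite ?oppr0 ?opprK.
have QN : - Q n = Q n by rewrite [in RHS]/Q DN.
by rewrite DN QN.
Qed.

(** Read am as [a, m], with D a = 0.  The bracket with a acts on the N-part by
    - (P m) a, which is why P turns the left action into the right one; the
    sign is absorbed by P m = - P m.  The three lemmas below are analogous. *)
Lemma kill_diag_lactM a m :
  F (a *<| m) = a *<| F m /\ P (a *<| m) = P m |>* a.
Proof.
have am : inM (a *<| m) = lbr (inA a) (inM m).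
  by rewrite lbr_inA !comps /lbr !simp0.
have [Dm PN] := kill_diag_inM m.
rewrite /F /P am kill_diag_lbr_inA lbr_inA !comps -/(F m) -/(P m).
by rewrite -ractNl PN.
Qed.

Lemma kill_diag_ractM m b :
  F (m |>* b) = F m |>* b /\ P (m |>* b) = b *<| P m.
Proof.
have mb : inM (m |>* b) = - lbr (inB b) (inM m).
  rewrite lbr_inB !comps /lbr !simp0.
  by congr ((_, _), (_, _)); rewrite ?oppr0 ?opprK.
have [Dm PN] := kill_diag_inM m.
rewrite /F /P mb (lie_derN lieD) kill_diag_lbr_inB lbr_inB !comps opprK.
by rewrite -/(F m) -/(P m) -lactNr PN.
Qed.

Lemma kill_diag_lactN b n :
  E (b *<| n) = b *<| E n /\ Q (b *<| n) = Q n |>* b.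
Proof.
have bn : inN (b *<| n) = lbr (inB b) (inN n).
  by rewrite lbr_inB !comps /lbr !simp0.
have [Dn QN] := kill_diag_inN n.
rewrite /E /Q bn kill_diag_lbr_inB lbr_inB !comps -/(E n) -/(Q n).
by rewrite -ractNl QN.
Qed.

Lemma kill_diag_ractN n a :
  E (n |>* a) = E n |>* a /\ Q (n |>* a) = a *<| Q n.
Proof.
have na : inN (n |>* a) = - lbr (inA a) (inN n).
  rewrite lbr_inA !comps /lbr !simp0.
  by congr ((_, _), (_, _)); rewrite ?oppr0 ?opprK.
have [Dn QN] := kill_diag_inN n.
rewrite /E /Q na (lie_derN lieD) kill_diag_lbr_inA lbr_inA !comps opprK.
by rewrite -/(E n) -/(Q n) -lactNr QN.
Qed.

(** The commutator [m, n] = mn - nm is diagonal, so D kills it; the two diagonal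
    entries of [D m, n] + [m, D n] = 0 are the identities of a special pair. *)
Lemma kill_diag_special_pair : special_pair K F E.
Proof.
have DMN m n : lbr (D (inM m)) (inN n) - lbr (D (inN n)) (inM m) = 0.
  rewrite -(lbr_anti (inM m)) -lieD.2 lbr_inM_inN.
  rewrite -[gmx _ _ _ _ _]/(diag (gmx K (MN K m n) 0 0 (- NM K n m))).
  by rewrite diag_split (lie_derD lieD) DA0 DB0 addr0.
have FE m n : gmx K (MN K (F m) n + MN K m (E n)) 0 0
                    (- (NM K n (F m) + NM K (E n) m)) = 0.
  rewrite -(DMN m n) (kill_diag_inM m).1 (kill_diag_inN n).1.
  rewrite lbr_inN lbr_inM !comps !simp0.
  by congr ((_, _), (_, _)); rewrite /= ?oppr0 ?addr0 ?opprK ?opprD.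
split.
- split; last by move=> m b; have [] := kill_diag_ractM m b.
    move=> r m m'; rewrite /F -[RHS]/(gM (r *: D (inM m) + D (inM m'))).
    rewrite -(lieD.1 r); congr (gM (D _)).
    by congr ((_, _), (_, _)); rewrite /= ?scaler0 addr0.
  by move=> a m; have [] := kill_diag_lactM a m.
- split; last by move=> n a; have [] := kill_diag_ractN n a.
    move=> r n n'; rewrite /E -[RHS]/(gN (r *: D (inN n) + D (inN n'))).
    rewrite -(lieD.1 r); congr (gN (D _)).
    by congr ((_, _), (_, _)); rewrite /= ?scaler0 addr0.
  by move=> b n; have [] := kill_diag_lactN b n.
- by move=> m n; have := congr1 (@gA _ _ _ _ _ K) (FE m n).
move=> m n; apply: oppr_inj; rewrite oppr0.
by have := congr1 (@gB _ _ _ _ _ K) (FE m n).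
Qed.

End KillDiagonal.

(** * Centrality in a faithful generalized matrix algebra *)

Section Faithful.
Hypothesis M_left_faithful : left_faithful M.
Hypothesis M_right_faithful : right_faithful M.
Hypothesis N_cond : forall u : N, (forall m : M, MN K m u = 0) ->
     (forall m : M, NM K u m = 0) -> u = 0.
Hypothesis M_cond : forall m : M, (forall u : N, NM K u m = 0) ->
     (forall u : N, MN K m u = 0) -> m = 0.

Lemma left_faithful_inj a a' : (forall m, a *<| m = a' *<| m) -> a = a'.
Proof.
move=> aa'; apply/subr0_eq/M_left_faithful => m.
by apply: (addIr (a' *<| m)); rewrite -lactDl subrK add0r.
Qed.

Lemma right_faithful_inj b b' : (forall m, m |>* b = m |>* b') -> b = b'.
Proof.
move=> bb'; apply/subr0_eq/M_right_faithful => m.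
by apply: (addIr (m |>* b')); rewrite -ractDr subrK add0r.
Qed.

Lemma center_gA0 z : center z -> gA z = 0 -> z = 0.
Proof.
move=> zc zA; have [zM zN] := center_offdiag zc.
apply: gma_eq0 => //; apply: M_right_faithful => m.
by rewrite -center_actM // zA lact0l.
Qed.

Lemma center_gB0 z : center z -> gB z = 0 -> z = 0.
Proof.
move=> zc zB; have [zM zN] := center_offdiag zc.
apply: gma_eq0 => //; apply: M_left_faithful => m.
by rewrite center_actM // zB ract0r.
Qed.

(** Commuting with M and N forces z to be diagonal, by [N_cond] and [M_cond];
    the two diagonal entries then act in the same way on M, and faithfulness
    makes them central, so that z commutes with A and B as well. *)
Lemma center_of_commute_MN z :
  (forall m, lbr z (inM m) = 0) -> (forall n, lbr z (inN n) = 0) -> center z.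
Proof.
move=> zM zN.
have NMz m : NM K (gN z) m = 0.
  by have := zM m; rewrite lbr_inM => /(congr1 (@gB _ _ _ _ _ K)).
have MNz m : MN K m (gN z) = 0.
  apply: oppr_inj; rewrite oppr0.
  by have := zM m; rewrite lbr_inM => /(congr1 (@gA _ _ _ _ _ K)).
have MzN n : MN K (gM z) n = 0.
  by have := zN n; rewrite lbr_inN => /(congr1 (@gA _ _ _ _ _ K)).
have NzM n : NM K n (gM z) = 0.
  apply: oppr_inj; rewrite oppr0.
  by have := zN n; rewrite lbr_inN => /(congr1 (@gB _ _ _ _ _ K)).
have gM0 : gM z = 0 by apply: M_cond.
have gN0 : gN z = 0 by apply: N_cond.
have actM m : gA z *<| m = m |>* gB z.
  have := zM m; rewrite lbr_inM => /(congr1 (@gM _ _ _ _ _ K)) /=.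
  exact: subr0_eq.
have actN n : gB z *<| n = n |>* gA z.
  have := zN n; rewrite lbr_inN => /(congr1 (@gN _ _ _ _ _ K)) /=.
  exact: subr0_eq.
have cA : center (gA z).
  by move=> a; apply: left_faithful_inj => m; rewrite -!lactA !actM lractA.
have cB : center (gB z).
  by move=> b; apply: right_faithful_inj => m; rewrite -!ractA -!actM lractA.
apply/centerP => x; rewrite (gma_split x) !lbrDr zM zN !addr0 diag_split lbrDr.
rewrite lbr_anti lbr_inA (lbr_anti z) lbr_inB gM0 gN0 !simp0.
by rewrite (center_lbrr _ cA) (center_lbrr _ cB) !oppr0 addr0.
Qed.

(** Compare the M-parts in D m = [D e, m] + [e, D m]: [lbr e] is the identity
    there, so the diagonal part of D e commutes with m.  On N both sides change
    sign. *)
Lemma center_diag_lie_der_e D : lie_derivation D -> center (diag (D e)).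
Proof.
move=> lieD; apply: center_of_commute_MN => [m | n].
  have: lbr (D e) (inM m) = D (inM m) - lbr e (D (inM m)).
    by rewrite -{2}(lbr_e_inM m) lieD.2 addrK.
  rewrite lbr_e !lbr_inM => /(congr1 (@gM _ _ _ _ _ K)).
  by rewrite !comps subrr !simp0 => ->.
have: lbr (D e) (inN n) = - D (inN n) - lbr e (D (inN n)).
  by rewrite -(lie_derN lieD) -lbr_e_inN lieD.2 addrK.
rewrite lbr_e !lbr_inN => /(congr1 (@gN _ _ _ _ _ K)).
by rewrite !comps opprK addNr !simp0 => ->.
Qed.

(** Since d e is central-valued, d [e, x] w = [e, d x w].  Expand
    d [e, x] [y, v] once as [e, d x [y, v]] with the Jacobi identity and once
    with the derivation rule in the second variable: two terms cancel. *)
Lemma bi_lie_exchange d x y v :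
    bi_lie_derivation d -> (forall z, center (d e z)) ->
  lbr (d x y) (lbr e v) = lbr (d x v) (lbr e y).
Proof.
case=> lie1 lie2 ec.
have eD w : d (lbr e x) w = lbr e (d x w).
  exact: (lie_der_lbr_center_l (lie2 w) x (ec w)).
have := (lie1 (lbr e x)).2 y v; rewrite !eD (lie1 x).2 lbrDr.
rewrite (lbr_leibniz e (d x y)) (lbr_leibniz e y) addrA => /addIr.
rewrite -addrA -[RHS]addr0 => /addrI /eqP.
by rewrite addr_eq0 -lbr_anti => /eqP.
Qed.

(** The elements m = [e, m] and - n = [e, n] all arise as some [e, v] in the
    exchange identity, whose right-hand side vanishes for y diagonal. *)
Lemma bi_lie_center_diagr d x y :
    bi_lie_derivation d -> (forall z, center (d e z)) ->
  lbr e y = 0 -> center (d x y).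
Proof.
move=> bid ec ey0; apply: center_of_commute_MN => [m | n].
  by rewrite -lbr_e_inM (bi_lie_exchange _ _ _ bid ec) ey0 lbr0r.
rewrite -(opprK (inN n)) -lbr_e_inN lbrNr (bi_lie_exchange _ _ _ bid ec) ey0.
by rewrite lbr0r oppr0.
Qed.

Lemma bi_lie_offdiag_diag d x y :
    bi_lie_derivation d -> (forall z, center (d e z)) ->
  lbr e y = 0 -> d (lbr e x) y = 0.
Proof.
move=> bid ec ey0; have [_ lie2] := bid.
rewrite (lie_der_lbr_center_l (lie2 y) x (ec y)).
exact/center_lbrr/bi_lie_center_diagr.
Qed.

(** * Vanishing by absence of central ideals *)

Section CentralIdeals.
Hypothesis no_central_ideal :
  no_nonzero_central_ideal A \/ no_nonzero_central_ideal B.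

(** The elements mu form a left ideal of A, the um a right ideal of B, and both
    consist of central elements; a central element of G with one zero diagonal
    entry is zero. *)
Lemma eq0_of_central_lbr_inN u :
  (forall m, center (lbr (inM m) (inN u))) -> u = 0.
Proof.
move=> uc; suff u0 m : lbr (inM m) (inN u) = 0.
  apply: N_cond => m; have := u0 m; rewrite lbr_inM_inN.
    by move=> /(congr1 (@gA _ _ _ _ _ K)).
  by move=> /(congr1 (@gB _ _ _ _ _ K)) /eqP; rewrite /= oppr_eq0 => /eqP.
case: no_central_ideal => noI.
  apply: center_gA0 (uc m) _; apply: (no_central_ideal_mull noI) => a.
  by have := center_gA (uc (a *<| m)); rewrite !lbr_inM_inN /= MN_l.
apply: center_gB0 (uc m) _; apply: (no_central_ideal_mulr noI) => b.
by have := center_gB (uc (m |>* b)); rewrite !lbr_inM_inN /= NM_r mulNr.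
Qed.

Lemma eq0_of_central_lbr_inM w :
  (forall n, center (lbr (inM w) (inN n))) -> w = 0.
Proof.
move=> wc; suff w0 n : lbr (inM w) (inN n) = 0.
  apply: M_cond => n; have := w0 n; rewrite lbr_inM_inN.
    by move=> /(congr1 (@gB _ _ _ _ _ K)) /eqP; rewrite /= oppr_eq0 => /eqP.
  by move=> /(congr1 (@gA _ _ _ _ _ K)).
case: no_central_ideal => noI.
  apply: center_gA0 (wc n) _; apply: (no_central_ideal_mulr noI) => a.
  by have := center_gA (wc (n |>* a)); rewrite !lbr_inM_inN /= MN_r.
apply: center_gB0 (wc n) _; apply: (no_central_ideal_mull noI) => b.
by have := center_gB (wc (b *<| n)); rewrite !lbr_inM_inN /= NM_l mulrN.
Qed.

(** For P: the exchange identity says m (P y) = y (P m) and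
    (P y) m = (P m) y.  With the skew linearity of P it follows that
    m (P y) + (P y) m, which equals [m, P y] because P y = - P y, commutes with
    M and N.  The same holds for Q. *)
Lemma kill_diag_skew_eq0 D :
    lie_derivation D -> (forall a, D (inA a) = 0) -> (forall b, D (inB b) = 0) ->
    (forall y v, lbr (D y) (lbr e v) = lbr (D v) (lbr e y)) ->
  (forall m, gN (D (inM m)) = 0) /\ (forall n, gM (D (inN n)) = 0).
Proof.
move=> lieD DA0 DB0 ex; split=> y.
  have symM m m' : lbr (D (inM m)) (inM m') = lbr (D (inM m')) (inM m).
    by have := ex (inM m) (inM m'); rewrite !lbr_e_inM.
  set P := fun m => gN (D (inM m)).
  have symA m m' : MN K m (P m') = MN K m' (P m).
    have := symM m' m; rewrite !lbr_inM => /(congr1 (@gA _ _ _ _ _ K)).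
    by rewrite !comps => /oppr_inj.
  have symB m m' : NM K (P m) m' = NM K (P m') m.
    by have := symM m m'; rewrite !lbr_inM => /(congr1 (@gB _ _ _ _ _ K)).
  have PN m : - P m = P m by have [] := kill_diag_inM lieD DA0 m.
  have Pl a m : P (a *<| m) = P m |>* a.
    by have [] := kill_diag_lactM lieD DA0 a m.
  have Pr m b : P (m |>* b) = b *<| P m.
    by have [] := kill_diag_ractM lieD DA0 DB0 m b.
  apply: eq0_of_central_lbr_inN => m; rewrite lbr_inM_inN -NMNl -/(P y) PN.
  apply: center_of_commute_MN => [m' | n].
    rewrite lbr_inM !comps !simp0; apply: gma_eq0; rewrite // comps.
    by rewrite MN_NM symB -MN_NM symA MN_NM (symB m) subrr.
  rewrite lbr_inN !comps !simp0; apply: gma_eq0; rewrite // comps.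
  by rewrite NM_MN -Pl MN_NM Pr NM_MN symA subrr.
have symN n n' : lbr (D (inN n)) (inN n') = lbr (D (inN n')) (inN n).
  have := ex (inN n) (inN n'); rewrite !lbr_e_inN !lbrNr.
  exact: oppr_inj.
set Q := fun n => gM (D (inN n)).
have symA n n' : MN K (Q n) n' = MN K (Q n') n.
  by have := symN n n'; rewrite !lbr_inN => /(congr1 (@gA _ _ _ _ _ K)).
have symB n n' : NM K n (Q n') = NM K n' (Q n).
  have := symN n' n; rewrite !lbr_inN => /(congr1 (@gB _ _ _ _ _ K)).
  by rewrite !comps => /oppr_inj.
have QN n : - Q n = Q n by have [] := kill_diag_inN lieD DA0 n.
have Ql b n : Q (b *<| n) = Q n |>* b.
  by have [] := kill_diag_lactN lieD DA0 DB0 b n.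
have Qr n a : Q (n |>* a) = a *<| Q n.
  by have [] := kill_diag_ractN lieD DA0 n a.
apply: eq0_of_central_lbr_inM => n; rewrite lbr_inM_inN -NMNr -/(Q y) QN.
apply: center_of_commute_MN => [m | n'].
  rewrite lbr_inM !comps !simp0; apply: gma_eq0; rewrite // comps.
  by rewrite MN_NM -Ql NM_MN Qr MN_NM symB subrr.
rewrite lbr_inN !comps !simp0; apply: gma_eq0; rewrite // comps.
by rewrite NM_MN symA -NM_MN symB NM_MN (symA n) subrr.
Qed.

(** The multipliers w of the maps [H t] absorb left multiplication by A, being
    determined by [H t] through faithfulness; so all the a w are central.  The
    multipliers w' behave likewise over B. *)
Lemma central_scaling_family_eq0 (T : Type) (H : T -> M -> M) :
    (forall t, exists (w : A) (w' : B), [/\ center w, center w',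
       forall m, H t m = w *<| m & forall m, H t m = m |>* w']) ->
    (forall a t, exists t', forall m, H t' m = a *<| H t m) ->
    (forall b t, exists t', forall m, H t' m = H t m |>* b) ->
  forall t m, H t m = 0.
Proof.
move=> scal lH rH t m; have [w [w' [wc wc' Hw Hw']]] := scal t.
case: no_central_ideal => noI.
  rewrite Hw (_ : w = 0) ?lact0l //; apply: (no_central_ideal_mull noI) => a.
  have [t' Ht'] := lH a t; have [v [_ [vc _ Hv _]]] := scal t'.
  rewrite (_ : a * w = v) //; apply: left_faithful_inj => m'.
  by rewrite -lactA -Hw -Ht' Hv.
rewrite Hw' (_ : w' = 0) ?ract0r //; apply: (no_central_ideal_mulr noI) => b.
have [t' Ht'] := rH b t; have [_ [v [_ vc _ Hv]]] := scal t'.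
rewrite (_ : w' * b = v) //; apply: right_faithful_inj => m'.
by rewrite -ractA -Hw' -Ht' Hv.
Qed.

(** The brackets of the off-diagonal parts of d e e with M and N are, up to
    sign, the diagonal parts of d e m and d e n, seen as values at e of the Lie
    derivations d(-, m) and d(-, n). *)
Lemma bi_lie_e_e d : bi_lie_derivation d -> center (d e e).
Proof.
case=> lie1 lie2.
have de0 : gN (d e e) = 0.
  apply: eq0_of_central_lbr_inN => m; rewrite lbr_anti.
  rewrite -(diag_lie_der_inM _ (lie1 e)); apply/centerN.
  exact: (center_diag_lie_der_e (lie2 _)).
have ed0 : gM (d e e) = 0.
  apply: eq0_of_central_lbr_inM => n; rewrite lbr_anti.
  rewrite -(diag_lie_der_inN _ (lie1 e)); apply/centerN.
  exact: (center_diag_lie_der_e (lie2 _)).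
have := center_diag_lie_der_e (lie1 e); rewrite /diag.
case: (d e e) de0 ed0 => [[a m] [n b]].
by rewrite /gA /gM /gN /gB /= => -> ->.
Qed.

(** * Central-valued Lie derivations in two variables *)

Section SpecialPairs.
Hypothesis piA_center : forall a : A,
  (exists z : G, center z /\ gA z = a) <-> center a.
Hypothesis piB_center : forall b : B,
  (exists z : G, center z /\ gB z = b) <-> center b.
Hypothesis special_standard : forall (F : M -> M) (E : N -> N),
  special_pair K F E -> standard_form F E.

(** The surjectivity of the center of G onto the centers of A and B allows a
    right multiplication by a central element of B to be rewritten as a left
    multiplication by a central element of A, and conversely. *)
Lemma special_pair_central F E : special_pair K F E ->
  exists (w : A) (w' : B), [/\ center w, center w',
    forall m, F m = w *<| m, forall m, F m = m |>* w'
    & forall n, E n = - (n |>* w)].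
Proof.
move=> /special_standard [w0 [w1 [w0c w1c Fw Ew]]].
have [z [zc zA]] := (piA_center w0).2 w0c.
have [t [tc tB]] := (piB_center w1).2 w1c.
exists (w0 + gA t), (gB z + w1); split.
- exact/centerD/center_gA.
- by apply: centerD => //; apply: center_gB.
- by move=> m; rewrite Fw lactDl (center_actM _ tc) tB.
- by move=> m; rewrite Fw ractDr -(center_actM _ zc) zA.
by move=> n; rewrite Ew ractDr -(center_actN _ tc) tB opprD.
Qed.

(** Diagonal x are covered by [bi_lie_center_diagr] with the variables
    exchanged; for off-diagonal x, all of which have the form [e, t], the map
    [d x] is in fact zero. *)
Lemma bi_lie_central d : bi_lie_derivation d ->
  (forall z, center (d e z)) -> (forall z, center (d z e)) ->
  forall x y, center (d x y).
Proof.
move=> bid ec ce x y; have [lie1 lie2] := bid.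
have bid' : bi_lie_derivation (fun u v => d v u) by [].
have eA a : lbr e (inA a) = 0 by rewrite lbr_e !comps oppr0.
have eB b : lbr e (inB b) = 0 by rewrite lbr_e !comps oppr0.
have killA t a : d (lbr e t) (inA a) = 0 by exact: bi_lie_offdiag_diag.
have killB t b : d (lbr e t) (inB b) = 0 by exact: bi_lie_offdiag_diag.
have killA' m a : d (inA a) (inM m) = 0.
  by rewrite -lbr_e_inM; apply: (bi_lie_offdiag_diag _ bid').
have killB' m b : d (inB b) (inM m) = 0.
  by rewrite -lbr_e_inM; apply: (bi_lie_offdiag_diag _ bid').
have sp t := kill_diag_special_pair (lie1 (lbr e t)) (killA t) (killB t).
have F0 t m : gM (d (lbr e t) (inM m)) = 0.
  move: t m; apply: central_scaling_family_eq0 => [t | a t | b t].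
  - have [w [w' [wc wc' Fw Fw' _]]] := special_pair_central (sp t).
    by exists w, w'; split.
  (* As a commutes with e, [e, [a, t]] = [a, [e, t]]; and d(-, m) kills A. *)
  - exists (lbr (inA a) t) => m; rewrite lbr_leibniz eA lbr0l add0r.
    have /= -> := kill_diag_lbr_inA (lie2 (inM m)) (killA' m) a (lbr e t).
    by rewrite (lbr_inA a (d _ _)) comps.
  exists (- lbr (inB b) t) => m; rewrite lbrNr lbr_leibniz eB lbr0l add0r.
  have /= -> := lie_derN (lie2 (inM m)) (lbr (inB b) (lbr e t)).
  have /= -> := kill_diag_lbr_inB (lie2 (inM m)) (killB' m) b (lbr e t).
  by rewrite (lbr_inB b (d _ _)) !comps opprK.
(* F = 0 forces the multiplier w, which E shares with F, to vanish. *)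
have E0 t n : gN (d (lbr e t) (inN n)) = 0.
  have [w [_ [_ _ Fw _ ->]]] := special_pair_central (sp t).
  rewrite (_ : w = 0) ?ract0r ?oppr0 //; apply: M_left_faithful => m.
  by rewrite -Fw F0.
have off0 t z : d (lbr e t) z = 0.
  have lieD := lie1 (lbr e t).
  have [P0 Q0] := kill_diag_skew_eq0 lieD (killA t) (killB t)
    (fun u v => bi_lie_exchange _ u v bid ec).
  rewrite (gma_split z) !(lie_derD lieD) diag_split (lie_derD lieD).
  rewrite killA killB (kill_diag_inM lieD (killA t) _).1.
  rewrite (kill_diag_inN lieD (killA t) _).1 F0 E0 P0 Q0.
  by apply: gma_eq0; rewrite !comps !addr0.
have -> : x = diag x + lbr e (lbr e x).
  rewrite {1}(gma_split x) !lbr_e !comps opprK -addrA; congr (_ + _).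
  by congr ((_, _), (_, _)); rewrite /= !simp0.
rewrite (lie_derD (lie2 y)) off0 addr0.
exact: (bi_lie_center_diagr _ bid' ce (lbr_e_diag x)).
Qed.

End SpecialPairs.
End CentralIdeals.
End Faithful.
End Peirce.

(** * Varying two slots of a multilinear map *)

Section Slots.
Variables (R : comPzRingType) (G : algType R) (n : nat).
Variables (phi : G ^ n -> G) (phi_nLie : n_lie_derivation phi).
Implicit Types (x : G ^ n) (i j : 'I_n).

Lemma updE x i : upd x i (x i) = x.
Proof. by apply/ffunP => k; rewrite ffunE; case: eqP => [->|]. Qed.

Lemma updC x i j u v :
  i != j -> upd (upd x i u) j v = upd (upd x j v) i u.
Proof.
move=> ij; apply/ffunP => k; rewrite !ffunE.
by have [-> | //] := eqVneq k j; rewrite eq_sym (negPf ij).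
Qed.

Lemma bi_lie_slots x i j :
  i != j -> bi_lie_derivation (fun u v => phi (upd (upd x i u) j v)).
Proof.
move=> ij; split=> [u | v]; first exact: phi_nLie.2 (upd x i u) j.
have [lin leib] := phi_nLie.2 (upd x j v) i.
split=> [r u u' | u u']; rewrite !(updC _ _ _ ij).
  exact: lin.
exact: leib.
Qed.

(** Exhibits a value of phi as one of the two-variable map of slots i and j. *)
Lemma upd_slots_id x i j : phi x = phi (upd (upd x i (x i)) j (x j)).
Proof. by rewrite !updE. Qed.

End Slots.

Theorem theoremB (R : comPzRingType)
  (R_2torsionfree : forall r : R, r *+ 2 = 0 -> r = 0)
  (A B : algType R) (M : bimodType A B) (N : bimodType B A)
  (MN_nonzero : (exists m : M, m != 0) \/ (exists u : N, u != 0))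
  (M_left_faithful : left_faithful M) (M_right_faithful : right_faithful M)
  (K : moritaContext M N)
  (n : nat) (n_ge3 : (3 <= n)%N)
  (phi : gma K ^ n -> gma K) (phi_nLie : n_lie_derivation phi)
  (piA_center : forall a : A,
     (exists z : gma K, center z /\ gA z = a) <-> center a)
  (piB_center : forall b : B,
     (exists z : gma K, center z /\ gB z = b) <-> center b)
  (no_central_ideal :
     no_nonzero_central_ideal A \/ no_nonzero_central_ideal B)
  (N_cond : forall u : N, (forall m : M, MN K m u = 0) ->
     (forall m : M, NM K u m = 0) -> u = 0)
  (M_cond : forall m : M, (forall u : N, NM K u m = 0) ->
     (forall u : N, MN K m u = 0) -> m = 0)
  (special_standard : forall (F : M -> M) (E : N -> N),
     special_pair K F E -> standard_form F E) :
  let e := gma_e K in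
  let f := gma_f K in
  let phi_e := phi [ffun => e] in
  let X0 := e * phi_e * f + (-1) ^+ n * (f * phi_e * e) in
  exists kappa psi : gma K ^ n -> gma K,
    [/\ forall x, phi x = kappa x + psi x,
        extremal_nder_of X0 kappa,
        multilinear psi,
        central_valued psi
      & vanishes_on_commutators psi].
Proof.
move=> e f phi_e X0.
have ee := bi_lie_e_e M_left_faithful M_right_faithful N_cond M_cond
  no_central_ideal.
have bic := bi_lie_central M_left_faithful M_right_faithful N_cond M_cond
  no_central_ideal piA_center piB_center special_standard.
pose i0 := Ordinal (ltn_trans (isT : 0 < 2) n_ge3 : 0 < n)%N.
pose i1 := Ordinal (ltn_trans (isT : 1 < 2) n_ge3 : 1 < n)%N.
pose i2 := Ordinal (n_ge3 : 2 < n)%N.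
have phi_ee (x : gma K ^ n) (i j : 'I_n) :
    i != j -> x i = e -> x j = e -> center (phi x).
  move=> ij xi xj; rewrite (upd_slots_id phi x i j) xi xj.
  exact: (ee _ (bi_lie_slots phi_nLie x ij)).
(* Slots j and k vary; each of them together with slot i gives two e's. *)
have phi_e1 (x : gma K ^ n) (i j k : 'I_n) :
    i != j -> i != k -> j != k -> x i = e -> center (phi x).
  move=> ij ik jk xi; rewrite (upd_slots_id phi x j k).
  apply: (bic _ (bi_lie_slots phi_nLie x jk)) => z.
    by apply: (phi_ee _ i j ij); rewrite !ffunE ?(negPf ij) ?(negPf ik)
      ?(negPf jk) ?eqxx.
  by apply: (phi_ee _ i k ik); rewrite !ffunE ?(negPf ij) ?(negPf ik) ?eqxx.
have phiC (x : gma K ^ n) : center (phi x).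
  have i01 : i0 != i1 by [].
  rewrite (upd_slots_id phi x i0 i1).
  apply: (bic _ (bi_lie_slots phi_nLie x i01)) => z.
    by apply: (phi_e1 _ i0 i1 i2); rewrite // !ffunE.
  by apply: (phi_e1 _ i1 i0 i2); rewrite // !ffunE.
have ef0 : e * f = 0.
  by congr ((_, _), (_, _)); rewrite /= !simp0.
have fe0 : f * e = 0.
  by congr ((_, _), (_, _)); rewrite /= !simp0.
(* phi_e is central, so both terms of X0 contain a factor ef or fe. *)
have X00 : X0 = 0.
  have phi_eC : center phi_e by exact: phiC.
  rewrite /X0 -(phi_eC e) -(phi_eC f) -[phi_e * e * f]mulrA ef0.
  by rewrite -[phi_e * f * e]mulrA fe0 !mulr0 addr0.
have iter0 (x : gma K ^ n) : iter_lbr x (0 : gma K) = 0.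
  by rewrite /iter_lbr; elim: [seq _ | _ in _] => //= y s ->; rewrite lbr0r.
exists (fun=> 0), phi; split.
- by move=> x; rewrite add0r.
- rewrite X00; split=> [x i r y z | x y | x]; last by rewrite iter0.
    by rewrite scaler0 addr0.
  by rewrite lbr0r.
- exact: phi_nLie.1.
- exact: phiC.
move=> x i y z xi; rewrite -(updE x i) xi.
have [_ ->] := phi_nLie.2 x i.
by rewrite (center_lbrl _ (phiC _)) (center_lbrr _ (phiC _)) addr0.
Qed.
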